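(* Let $n,m$ be positive integers. Suppose $\mathbb{R}P^{n-1}$ cannot be embedded into $\mathbb{R}^m$ because of the deleted square obstruction, i.e. there is no $\mathbb{Z}_2$-equivariant continuous map $$\left(\mathbb{R}P^{n-1}\times\mathbb{R}P^{n-1}\right)\setminus\Delta(\mathbb{R}P^{n-1})\to S^{m-1}.$$ Let $\mu_0,\ldots,\mu_m$ be $m+1$ absolutely continuous probability measures on $\mathbb{R}P^{n-1}$. Then there exists a pair of hyperplanes $H_1,H_2\subseteq\mathbb{R}P^{n-1}$ partitioning every measure $\mu_i$, $0\le i\le m$, into two equal parts.
   Context: For a space $M$, $\Delta(M)\subset M\times M$ is the diagonal; $\mathbb{Z}_2$ acts on the deleted square $(M\times M)\setminus\Delta(M)$ by interchanging coordinates and on $S^{m-1}$ antipodally. The deleted square obstruction to an embedding $M\to\mathbb{R}^m$ is the obstruction to the existence of a $\mathbb{Z}_2$-equivariant map $(M\times M)\setminus\Delta(M)\to S^{m-1}$. A hyperplane in $\mathbb{R}P^{n-1}$ is the projectivization of a linear hyperplane of $\mathbb{R}^n$. One hyperplane does not separate $\mathbb{R}P^{n-1}$, but two distinct hyperplanes $H_1=\{\langle x,v_1\rangle=0\}$, $H_2=\{\langle x,v_2\rangle=0\}$ partition it into two parts, $\{[x]:\langle x,v_1\rangle\langle x,v_2\rangle>0\}$ and $\{[x]:\langle x,v_1\rangle\langle x,v_2\rangle<0\}$; the pair partitions $\mu$ into two equal parts if each of these has $\mu$-measure $\tfrac12$. *)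

(* Defs.v *)
From HB Require Import structures.
From mathcomp Require Import all_boot all_order all_algebra.
From mathcomp Require Import all_classical all_reals all_analysis.

Set Implicit Arguments.
Unset Strict Implicit.
Unset Printing Implicit Defensive.

Import Order.TTheory GRing.Theory Num.Theory.
Import numFieldNormedType.Exports.

Local Open Scope classical_set_scope.
Local Open Scope ring_scope.
Local Open Scope quotient_scope.

Definition dot (R : realType) (n : nat) (x y : 'rV[R]_n) : R :=
  \sum_(i < n) x 0 i * y 0 i.

(* R^n minus the origin, with the topology induced from R^n. *)
Definition punctured (R : realType) (n : nat) : Type :=
  set_type [set x : 'rV[R]_n | x != 0].

HB.instance Definition _ (R : realType) (n : nat) :=
  Choice.copy (punctured R n) (set_type [set x : 'rV[R]_n | x != 0]).
HB.instance Definition _ (R : realType) (n : nat) :=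
  Topological.copy (punctured R n) (set_type [set x : 'rV[R]_n | x != 0]).

Definition punctured_val (R : realType) (n : nat) (x : punctured R n) :
  'rV[R]_n := \val x.
Coercion punctured_val : punctured >-> matrix.

Section projective_space.
Variables (R : realType) (k : nat).

Definition same_line (x y : punctured R k.+1) : bool :=
  `[< exists2 c : R, c != 0 & (y : 'rV[R]_k.+1) = c *: (x : 'rV[R]_k.+1) >].

Lemma same_line_refl : reflexive same_line.
Proof. by move=> x; apply/asboolP; exists 1; rewrite ?oner_neq0// scale1r. Qed.

Lemma same_line_sym : symmetric same_line.
Proof.
suff sub x y : same_line x y -> same_line y x.
  by move=> x y; apply/idP/idP; exact: sub.
move=> /asboolP[c c0 e]; apply/asboolP; exists c^-1; first by rewrite invr_eq0.
by rewrite e scalerA mulVf// scale1r.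
Qed.

Lemma same_line_trans : transitive same_line.
Proof.
move=> y x z /asboolP[c c0 e] /asboolP[d d0 f]; apply/asboolP; exists (d * c).
  by rewrite mulf_neq0.
by rewrite f e scalerA.
Qed.

Definition same_line_equiv :=
  EquivRel same_line same_line_refl same_line_sym same_line_trans.

(* The k-dimensional projective space, i.e. the lines of R^(k+1), with the
   quotient topology and its Borel sigma-algebra. *)
Definition RP : Type := {eq_quot same_line_equiv}.

HB.instance Definition _ := Topological.copy RP (quotient_topology RP).
HB.instance Definition _ := Quotient.on RP.

Definition RP_class (x : punctured R k.+1) : RP := \pi_RP x.

Definition chart_vector (i : 'I_k.+1) (y : 'rV[R]_k) : 'rV[R]_k.+1 :=
  \row_j (if unlift i j is Some l then y 0 l else 1).

Lemma chart_vector_neq0 i y : chart_vector i y \in [set x : 'rV[R]_k.+1 | x != 0].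
Proof.
apply/mem_set/eqP => /matrixP/(_ 0 i).
by rewrite !mxE unlift_none => /eqP; rewrite oner_eq0.
Qed.

(* Inverse of the affine chart [x] |-> (x_j / x_i)_(j != i) of {x_i != 0}. *)
Definition chart_inv (i : 'I_k.+1) (y : 'rV[R]_k) : RP :=
  RP_class (Sub (chart_vector i y) (chart_vector_neq0 i y)).

HB.instance Definition _ := isPointed.Build RP (chart_inv ord0 0).

HB.instance Definition _ :=
  Measurable.copy RP (g_sigma_algebraType (@open RP)).

Definition hyperplane (v : punctured R k.+1) : set RP :=
  [set RP_class x | x in [set x : punctured R k.+1 | dot x v = 0]].

Definition positive_part (v1 v2 : punctured R k.+1) : set RP :=
  [set RP_class x | x in [set x : punctured R k.+1 | 0 < dot x v1 * dot x v2]].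

Definition negative_part (v1 v2 : punctured R k.+1) : set RP :=
  [set RP_class x | x in [set x : punctured R k.+1 | dot x v1 * dot x v2 < 0]].

Definition bisects (v1 v2 : punctured R k.+1) (mu : probability RP R) : Prop :=
  mu (positive_part v1 v2) = (2^-1 : R)%:E /\
  mu (negative_part v1 v2) = (2^-1 : R)%:E.

(* The points of RP x RP off the diagonal. *)
Definition deleted_square : set (RP * RP) := ~` diagonal.

End projective_space.

(* Subsets of R^n of n-dimensional Lebesgue measure zero. The index set D makes
   empty and finite covers available, which matters when n = 0, where the only
   box is the whole space and has volume 1. *)
Definition lebesgue_null (R : realType) (n : nat) (A : set 'rV[R]_n) : Prop :=
  forall e : R, 0 < e ->
  exists (D : set nat) (a b : nat -> 'rV[R]_n),
    [/\ forall i j, a i 0 j <= b i 0 j,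
        A `<=` \bigcup_(i in D) [set y | forall j, a i 0 j <= y 0 j <= b i 0 j] &
        (\esum_(i in D) (\prod_j (b i 0 j - a i 0 j))%:E <= e%:E)%E].

(* Measure zero in the smooth manifold RP: measure zero in every affine chart. *)
Definition RP_null (R : realType) (k : nat) (A : set (RP R k)) : Prop :=
  forall i : 'I_k.+1, lebesgue_null (chart_inv i @^-1` A).

Definition absolutely_continuous (R : realType) (k : nat)
    (mu : probability (RP R k) R) : Prop :=
  forall A : set (RP R k), measurable A -> RP_null A -> mu A = 0%E.

(* S^(m-1), as a subset of R^m. *)
Definition sphere (R : realType) (m : nat) : set 'rV[R]_m :=
  [set x | dot x x = 1].

(* The values of f on the diagonal are irrelevant. *)
Definition equivariant_to_sphere (R : realType) (k m : nat)
    (f : RP R k * RP R k -> 'rV[R]_m) : Prop :=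
  [/\ {within @deleted_square R k, continuous f},
      set_fun (@deleted_square R k) (@sphere R m) f &
      forall p q : RP R k, deleted_square (p, q) -> f (q, p) = - f (p, q)].

(* Main.v *)
Require Import Defs.
From mathcomp Require Import all_boot all_order all_algebra.
From mathcomp Require Import all_classical all_reals all_analysis.
From mathcomp Require Import ring lra.

(** Two distinct lines [a] and [b], given by unit vectors, and a parameter [s]
    in [0, 1] define the pair of hyperplanes with normal vectors
    [v1 = (1 - s) a + s b] and [v2 = (1 - s) a - s b]. Since
      [<x, v1> <x, v2> = (1 - s)^2 <x, a>^2 - s^2 <x, b>^2],
    the two parts depend only on the lines, and not on the choice of signs.
    Exchanging [a] with [b] and [s] with [1 - s] exchanges the two parts.

    The imbalance of a measure is the measure of the positive part minus that of
    the negative part. For an absolutely continuous measure it is a continuous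
    function of the pair of nonzero normal vectors
    ([imbalance_continuous]): hyperplanes are null sets
    ([lebesgue_null_affine_hyperplane], [RP_null_hyperplane]), and a small change
    of the vectors moves only points of a thin neighbourhood of the hyperplanes.

    Suppose that no pair bisects all measures. By compactness the sum of the
    absolute imbalances is at least some [d > 0] ([imbalance_bounded_below]).
    For given [a] and [b], choose [s] so that the first measure is nearly
    bisected. A median need be neither unique nor continuous in [a] and [b], so
    instead [s] is the zero of the imbalance plus [e (1 - 2 s)], with [e = d / 2]:
    this is strictly decreasing in [s], positive at [0] and negative at [1], so
    its zero is unique and continuous ([balance_continuous]), and becomes [1 - s]
    when [a] and [b] are exchanged ([balance_swap]). At this [s] the imbalance of
    the first measure is at most [e < d] in absolute value, so the imbalances of
    the [m] other measures do not all vanish. They change sign when [a] and [b]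
    are exchanged; after normalization they form an equivariant map from the
    deleted square to the sphere ([line_map_equivariant]), which does not exist. *)

Set Implicit Arguments.
Unset Strict Implicit.
Unset Printing Implicit Defensive.

Import Order.TTheory GRing.Theory Num.Theory.
Import numFieldNormedType.Exports.

Local Open Scope classical_set_scope.
Local Open Scope ring_scope.
Local Open Scope quotient_scope.

(** * The scalar product *)

Section Dot.
Variables (R : realType) (n : nat).
Implicit Types u v w : 'rV[R]_n.

Lemma dotZl (c : R) u v : dot (c *: u) v = c * dot u v.
Proof. by rewrite /dot mulr_sumr; apply: eq_bigr => i _; rewrite mxE mulrA. Qed.

Lemma dotC u v : dot u v = dot v u.
Proof. by apply: eq_bigr => i _; rewrite mulrC. Qed.

Lemma dotZr (c : R) u v : dot u (c *: v) = c * dot u v.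
Proof. by rewrite dotC dotZl dotC. Qed.

Lemma dotDr u v w : dot u (v + w) = dot u v + dot u w.
Proof. by rewrite /dot -big_split; apply: eq_bigr => i _; rewrite mxE mulrDr. Qed.

Lemma dotNr u v : dot u (- v) = - dot u v.
Proof. by rewrite -scaleN1r dotZr mulN1r. Qed.

Lemma dot_gt0 u : u != 0 -> 0 < dot u u.
Proof.
move=> u0; rewrite lt_neqAle sumr_ge0 ?andbT; last first.
  by move=> i _; rewrite -expr2 sqr_ge0.
apply: contra u0; rewrite eq_sym psumr_eq0 => [/allP h|i _]; last first.
  by rewrite -expr2 sqr_ge0.
apply/eqP/rowP => i; rewrite mxE.
by have := h i; rewrite mem_index_enum -expr2 sqrf_eq0 => /(_ isT)/eqP.
Qed.

Lemma cvg_dot (T : Type) (F : set_system T) {FF : Filter F}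
    (f g : T -> 'rV[R]_n) u v :
  f @ F --> u -> g @ F --> v -> dot (f t) (g t) @[t --> F] --> dot u v.
Proof.
move=> fu gv; apply: cvg_big => [|i _]; first exact: add_continuous.
apply: cvgM.
  by apply: (cvg_comp f (fun w : 'rV[R]_n => w 0 i) fu); exact: coord_continuous.
by apply: (cvg_comp g (fun w : 'rV[R]_n => w 0 i) gv); exact: coord_continuous.
Qed.

End Dot.

(** * Subsets of projective space defined by homogeneous conditions *)

Section Lines.
Variables (R : realType) (k : nat).
Implicit Types (x y : punctured R k.+1) (u v w : 'rV[R]_k.+1).

Lemma punctured_neq0 x : (x : 'rV[R]_k.+1) != 0.
Proof. by have := valP x; rewrite inE. Qed.

(** The point of the punctured space given by a nonzero vector. *)
Definition mkpunct u (u0 : u != 0) : punctured R k.+1 :=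
  Sub u (mem_set (u0 : [set z : 'rV[R]_k.+1 | z != 0] u)).

Lemma mkpunctE u (u0 : u != 0) : mkpunct u0 = u :> 'rV[R]_k.+1.
Proof. exact: (SubK (set_type [set z : 'rV[R]_k.+1 | z != 0])). Qed.

Lemma RP_classP x y :
  RP_class x = RP_class y <->
  exists2 c : R, c != 0 & (y : 'rV[R]_k.+1) = c *: (x : 'rV[R]_k.+1).
Proof.
have e := @eqmodP _ (same_line_equiv R k) x y.
split=> [h|h]; first exact/asboolP/e.
by apply/e; apply/asboolP.
Qed.

Lemma RP_class_surj (p : RP R k) : exists x, p = RP_class x.
Proof. by exists (repr p); rewrite /RP_class reprK. Qed.

(** The set of all lines spanned by the nonzero vectors of [P]. *)
Definition lines (P : set 'rV[R]_k.+1) : set (RP R k) :=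
  [set RP_class x | x in [set x : punctured R k.+1 | P x]].

(** Invariance under nonzero scaling: [P] is, up to the origin, a union of
    lines. *)
Definition cone (P : set 'rV[R]_k.+1) :=
  forall (c : R) u, c != 0 -> P u -> P (c *: u).

Lemma lines_class P x : cone P -> lines P (RP_class x) <-> P x.
Proof.
move=> cP; split=> [[y /= Py /RP_classP [c c0 ->]]|Px]; first exact: cP.
by exists x.
Qed.

Lemma linesC P : cone P -> ~` lines P = lines (~` P).
Proof.
move=> cP; have cPC : cone (~` P).
  move=> c u c0 nP /(cP c^-1 _); rewrite scalerA mulVf // scale1r.
  by move=> h; apply: nP; apply: h; rewrite invr_eq0.
apply/seteqP; split=> p; have [x ->] := RP_class_surj p.
  by move=> h; apply/lines_class => // Px; apply: h; apply/lines_class.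
by move=> /(lines_class _ cPC) nP /(lines_class _ cP).
Qed.

Lemma lines_subset P Q : P `<=` Q -> lines P `<=` lines Q.
Proof. by move=> PQ p [x Px <-]; exists x => //; exact: PQ. Qed.

Lemma punctured_val_continuous : continuous (@punctured_val R k.+1).
Proof. exact: (@initial_continuous _ _ set_val). Qed.

(** The projection to [RP] is open: the preimage of [lines P] is the union of the
    rescaled copies of [P]. *)
Lemma open_lines P : open P -> open (lines P).
Proof.
move=> oP; rewrite /open /= /quotient_open.
have -> : \pi_(quotient_topology (RP R k)) @^-1` lines P =
    \bigcup_(c in [set c : R | c != 0])
      ((fun x : punctured R k.+1 => c *: (x : 'rV[R]_k.+1)) @^-1` P).
  apply/seteqP; split=> [x /= [y Py /esym/RP_classP[c c0 e]]|x [c /= c0 Px]].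
    by exists c => //=; rewrite -e.
  have cx0 : c *: punctured_val x != 0.
    by rewrite scaler_eq0 negb_or c0 punctured_neq0.
  exists (mkpunct cx0); first by rewrite /= mkpunctE.
  by apply/esym/RP_classP; exists c; rewrite // mkpunctE.
apply: bigcup_open => c _; apply: open_comp => // x _.
apply: (continuous_comp (g := fun u : 'rV[R]_k.+1 => c *: u)).
  exact: punctured_val_continuous.
exact: scaler_continuous.
Qed.

Lemma nbhs_lines x (A : set 'rV[R]_k.+1) :
  nbhs (x : 'rV[R]_k.+1) A -> nbhs (RP_class x) (lines A).
Proof.
rewrite nbhsE => -[U [oU Ux] UA].
apply: (filterS (lines_subset UA)); apply: open_nbhs_nbhs; split.
  exact: open_lines.
by exists x.
Qed.

Lemma measurable_lines P : open P -> measurable (lines P).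
Proof. by move=> /open_lines oP; apply: sub_sigma_algebra. Qed.

Lemma measurable_linesC P : cone P -> closed P -> measurable (lines P).
Proof.
move=> cP cl; have -> : lines P = ~` lines (~` P).
  by rewrite -linesC // setCK.
apply: measurableC; apply: measurable_lines; exact: closed_openC.
Qed.

End Lines.

(** * Null sets and hyperplanes *)

Section NullSets.
Variables (R : realType) (n : nat).
Implicit Types (A B : set 'rV[R]_n).

Lemma lebesgue_null_subset A B : A `<=` B -> lebesgue_null B -> lebesgue_null A.
Proof.
move=> AB nB e /nB [D [a [b [ab cov sm]]]]; exists D, a, b; split => //.
exact: subset_trans cov.
Qed.

(** The cover may be indexed by any countable type, instead of [nat]. *)
Lemma lebesgue_null_countable_cover A :
  (forall e : R, 0 < e -> exists (T : countType) (D : set T) (a b : T -> 'rV[R]_n),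
    [/\ forall t j, a t 0 j <= b t 0 j,
        A `<=` \bigcup_(t in D) [set y | forall j, a t 0 j <= y 0 j <= b t 0 j] &
        (\esum_(t in D) (\prod_j (b t 0 j - a t 0 j))%:E <= e%:E)%E]) ->
  lebesgue_null A.
Proof.
move=> h e /h [T [D [a [b [ab cov sm]]]]].
pose ext (f : T -> 'rV[R]_n) i := if unpickle i is Some t then f t else 0.
exists (pickle @` D), (ext a), (ext b); split=> [i j|y Ay|].
- by rewrite /ext; case: unpickle => // ; rewrite lexx.
- have [t Dt yt] := cov y Ay.
  by exists (pickle t); [by exists t|by rewrite /ext /= pickleK].
- rewrite (reindex_esum D (pickle @` D) pickle); last first.
    split; [by move=> t Dt; exists t| |by []].
    by move=> x y _ _; apply: (pcan_inj pickleK).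
  by apply: le_trans sm; apply: le_esum => t _; rewrite /ext pickleK.
Qed.

Lemma lebesgue_null_finite_cover A :
  (forall e : R, 0 < e -> exists (T : finType) (a b : T -> 'rV[R]_n),
    [/\ forall t j, a t 0 j <= b t 0 j,
        forall y, A y -> exists t, forall j, a t 0 j <= y 0 j <= b t 0 j &
        \sum_t \prod_j (b t 0 j - a t 0 j) <= e]) ->
  lebesgue_null A.
Proof.
move=> h; apply: lebesgue_null_countable_cover => e /h [T [a [b [ab cov sm]]]].
exists T, setT, a, b; split => // [y /cov [t yt]|]; first by exists t.
have vge0 t : 0 <= \prod_j (b t 0 j - a t 0 j).
  by apply: prodr_ge0 => j _; rewrite subr_ge0.
rewrite esum_fset; [|exact: finite_finset|by move=> t _; rewrite lee_fin].
have -> : [set: T] = [set` index_enum T].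
  by apply/seteqP; split=> t _ //=; rewrite mem_index_enum.
by rewrite -fsbig_seq ?index_enum_uniq // sumEFin lee_fin.
Qed.

Lemma lebesgue_null_bigcup (A : nat -> set 'rV[R]_n) :
  (forall N, lebesgue_null (A N)) -> lebesgue_null (\bigcup_N A N).
Proof.
move=> nA; apply: lebesgue_null_countable_cover => e e0.
have eN (N : nat) : 0 < e / (2 ^ N.+1)%:R by rewrite divr_gt0// ltr0n expn_gt0.
have /choice [D /choice [a /choice [b hab]]] := fun N => nA N _ (eN N).
exists (nat * nat)%type, ([set: nat] `*`` D),
  (fun t => a t.1 t.2), (fun t => b t.1 t.2); split.
- by move=> t j; have [ab _ _] := hab t.1.
- move=> y [N _ ANy]; have [_ /(_ y ANy) [i Di yi] _] := hab N.
  by exists (N, i).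
- rewrite -(esum_esum (a := fun N i => (\prod_j (b N i 0 j - a N i 0 j))%:E)); last first.
    move=> N i _ _; rewrite lee_fin prodr_ge0 // => j _; rewrite subr_ge0.
    by have [ab _ _] := hab N.
  apply: (@le_trans _ _ (\esum_(N in [set: nat]) (e / (2 ^ N.+1)%:R)%:E)%E).
    by apply: le_esum => N _; have [_ _] := hab N.
  rewrite -nneseries_esumT; last by move=> N; rewrite lee_fin ltW.
  have := @epsilon_trick R (fun=> 0%E) e xpredT (fun=> lexx _) (ltW e0).
  rewrite [X in (_ <= X + _)%E]eseries0 // add0e; apply: le_trans.
  apply: lee_nneseries => [N _ _|N _]; last by rewrite /= add0e.
  by rewrite lee_fin ltW.
Qed.

Lemma lebesgue_null_set0 : lebesgue_null (set0 : set 'rV[R]_n).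
Proof.
move=> e e0; exists set0, (fun=> 0), (fun=> 0); split => //.
by rewrite esum_set0 lee_fin ltW.
Qed.

End NullSets.

(** A bounded piece of the graph of an affine function is null: the cube of side
    [2 * M] in the other coordinates is cut into [N ^ n] cells of side
    [h = 2 * M / N], over each of which the function deviates by at most [L * h]
    from its value at the lowest corner. The total volume of the boxes,
    [(2 * M) ^ n * 2 * L * h], tends to [0] as [N] grows. *)
Lemma lebesgue_null_bounded_graph (R : realType) (n : nat) (j0 : 'I_n.+1)
    (c : 'I_n -> R) (d M : R) : 0 < M ->
  lebesgue_null [set y : 'rV[R]_n.+1 |
    y 0 j0 = d + \sum_l c l * y 0 (lift j0 l) /\
    forall l, - M <= y 0 (lift j0 l) < M].
Proof.
move=> M0; apply: lebesgue_null_finite_cover => e e0.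
pose L : R := \sum_l `|c l|.
have L0 : 0 <= L by apply: sumr_ge0.
pose V := (2 * M) ^+ n * (2 * L * (2 * M)).
have V0 : 0 <= V by rewrite !mulr_ge0 // ?exprn_ge0 // ?mulr_ge0 // ltW.
pose N := (Num.truncn (V / e)).+1.
have N0 : 0 < N%:R :> R by rewrite ltr0n.
have VN : V / N%:R <= e.
  rewrite ler_pdivrMr // mulrC -ler_pdivrMr //; apply/ltW.
  exact: truncnS_gt.
pose h := 2 * M / N%:R.
have h0 : 0 < h by rewrite divr_gt0 // mulr_gt0.
pose lo (g : {ffun 'I_n -> 'I_N}) l := - M + h * (g l)%:R.
pose f g := d + \sum_l c l * lo g l.
pose a (g : {ffun 'I_n -> 'I_N}) : 'rV[R]_n.+1 :=
  \row_j if unlift j0 j is Some l then lo g l else f g - L * h.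
pose b (g : {ffun 'I_n -> 'I_N}) : 'rV[R]_n.+1 :=
  \row_j if unlift j0 j is Some l then lo g l + h else f g + L * h.
have Lh0 : 0 <= L * h by rewrite mulr_ge0 // ltW.
exists {ffun 'I_n -> 'I_N}, a, b; split.
- by move=> g j; rewrite !mxE; case: unliftP => [l _|_]; lra.
- move=> y [yj0 yM].
  have ybound l : 0 <= (y 0 (lift j0 l) + M) / h.
    by have /andP[? _] := yM l; rewrite divr_ge0 ?(ltW h0) //; lra.
  (* The upper bound on y is strict, so its cell index is less than N. *)
  have yN l : (Num.truncn ((y 0 (lift j0 l) + M) / h)%R < N)%N.
    rewrite truncn_lt_nat // ltr_pdivrMr // /h mulrCA divff ?lt0r_neq0 //.
    by have /andP[_ ?] := yM l; lra.
  pose g : {ffun 'I_n -> 'I_N} := [ffun l => Ordinal (yN l)].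
  have gP l : lo g l <= y 0 (lift j0 l) < lo g l + h.
    have /andP[] := truncn_itv (ybound l).
    rewrite ler_pdivlMr // ltr_pdivrMr // -natr1 => h1 h2.
    by rewrite /lo ffunE /=; apply/andP; split; lra.
  exists g => j; rewrite !mxE; case: unliftP => [l ->|->].
    by have /andP[-> /ltW ->] := gP l.
  have : `|\sum_l c l * y 0 (lift j0 l) - \sum_l c l * lo g l| <= L * h.
    rewrite -sumrB mulr_suml; apply: (le_trans (ler_norm_sum _ _ _)).
    apply: ler_sum => l _; rewrite -mulrBr normrM ler_wpM2l //.
    by have /andP[? ?] := gP l; rewrite ger0_norm; lra.
  by rewrite ler_norml yj0 /f => /andP[? ?]; apply/andP; split; lra.
- rewrite (eq_bigr (fun=> h ^+ n * (2 * L * h))); last first.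
    move=> g _; rewrite (bigD1_ord j0) //= mulrC; congr (_ * _); last first.
      by rewrite !mxE unlift_none; lra.
    rewrite (eq_bigr (fun=> h)) ?prodr_const ?card_ord // => l _.
    by rewrite !mxE liftK addrAC subrr add0r.
  rewrite sumr_const card_ffun !card_ord.
  apply: le_trans VN; rewrite le_eqVlt; apply/orP; left; apply/eqP.
  rewrite -[LHS]mulr_natl natrX mulrA -exprMn.
  have -> : N%:R * h = 2 * M by rewrite /h mulrCA divff ?lt0r_neq0 // mulr1.
  by rewrite /V /h !mulrA.
Qed.

(** When [c = 0] and [d != 0] the set is empty; otherwise it is a countable union
    of bounded pieces of the graph of an affine function. *)
Lemma lebesgue_null_affine_hyperplane (R : realType) (n : nat)
    (c : 'I_n -> R) (d : R) : (d != 0) || [exists l, c l != 0] ->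
  lebesgue_null [set y : 'rV[R]_n | d + \sum_l y 0 l * c l = 0].
Proof.
move=> cd; have [c0|] := boolP [forall l, c l == 0].
  apply: lebesgue_null_subset (@lebesgue_null_set0 R n) => y /=.
  rewrite big1 => [|l _]; last by rewrite (eqP (forallP c0 l)) mulr0.
  rewrite addr0 => d0; move: cd; rewrite d0 eqxx /= => /existsP[l].
  by rewrite (eqP (forallP c0 l)) eqxx.
rewrite negb_forall => /existsP[j0] {cd}.
case: n c j0 => [c []//|n c j0 cj0].
(* The equation is solved for the coordinate j0. *)
pose c' l := - (c (lift j0 l) / c j0).
apply: (@lebesgue_null_subset _ _ _ (\bigcup_N [set y : 'rV[R]_n.+1 |
    y 0 j0 = - (d / c j0) + \sum_l c' l * y 0 (lift j0 l) /\
    forall l, - N.+1%:R <= y 0 (lift j0 l) < N.+1%:R])); last first.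
  by apply: lebesgue_null_bigcup => N; exact: lebesgue_null_bounded_graph.
move=> y /= ; rewrite (bigD1_ord j0) //= => hy.
exists (Num.truncn `|y|) => //; split.
  rewrite [X in _ + X](_ : _ = - (\sum_l y 0 (lift j0 l) * c (lift j0 l)) / c j0).
    by apply: (mulIf cj0); rewrite mulrDl mulNr !divfK //; lra.
  rewrite -sumrN mulr_suml; apply: eq_bigr => l _.
  by rewrite /c'; field.
move=> l; have : `|y 0 (lift j0 l)| < (Num.truncn `|y|).+1%:R.
  apply: le_lt_trans (truncnS_gt _).
  rewrite [leRHS]mx_normrE.
  exact: (le_bigmax _ (fun ij => `|y ij.1 ij.2|) (ord0, lift j0 l)).
by rewrite ltr_norml => /andP[/ltW -> ->].
Qed.

Section Hyperplanes.
Variables (R : realType) (k : nat).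
Implicit Types u v : 'rV[R]_k.+1.

Lemma cone_hyperplane v : cone [set u | dot u v = 0].
Proof. by move=> c u _ /= h; rewrite dotZl h mulr0. Qed.

Lemma RP_null_hyperplane v : v != 0 -> RP_null (lines [set u | dot u v = 0]).
Proof.
move=> v0 i.
apply: (@lebesgue_null_subset _ _ _
  [set y | v 0 i + \sum_l y 0 l * v 0 (lift i l) = 0]); last first.
  apply: lebesgue_null_affine_hyperplane; apply: contraR v0.
  rewrite negb_or negbK negb_exists => /andP[vi /forallP vl].
  apply/eqP/rowP => j; rewrite mxE; case: (unliftP i j) => [l ->|->].
    by have := vl l; rewrite negbK => /eqP.
  exact/eqP.
move=> y /= /(lines_class _ (@cone_hyperplane v)) /=.
rewrite [punctured_val _](SubK (set_type [set x : 'rV[R]_k.+1 | x != 0])).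
rewrite /dot (bigD1_ord i) //= mxE unlift_none mul1r => h.
rewrite -[RHS]h; congr (_ + _); apply: eq_bigr => l _.
by rewrite mxE liftK.
Qed.

End Hyperplanes.

(** * Imbalance of a measure between the two parts *)

Section Quadrants.
Variables (R : realType) (k : nat).
Implicit Types u v x : 'rV[R]_k.+1.

Lemma dot_continuous u : continuous (fun x => dot x u).
Proof.
by move=> x; apply: (@cvg_dot _ _ _ (nbhs x) _ id (fun=> u)); [exact: cvg_id|exact: cvg_cst].
Qed.

Lemma dot_prod_continuous u v : continuous (fun x => dot x u * dot x v).
Proof. by move=> x; exact: (cvgM (@dot_continuous u x) (@dot_continuous v x)). Qed.

Lemma ler_norm_dot x u : `|dot x u| <= k.+1%:R * `|x| * `|u|.
Proof.
have le_coord (w : 'rV[R]_k.+1) (i : 'I_k.+1) : `|w 0 i| <= `|w| :> R.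
  by rewrite [leRHS]mx_normrE; exact: (le_bigmax _ (fun ij => `|w ij.1 ij.2|) (ord0, i)).
apply: (le_trans (ler_norm_sum _ _ _)).
apply: (@le_trans _ _ (\sum_(i < k.+1) `|x| * `|u|)).
  by apply: ler_sum => i _; rewrite normrM ler_pM.
by rewrite sumr_const card_ord -[leLHS]mulr_natl mulrA.
Qed.

(** The lines on which the linear forms of [u] and [v] are nonzero and of the same
    sign. For nonzero [u] and [v] this is the positive part, and replacing [v] by
    [- v] gives the negative part. *)
Definition same_side u v : set (RP R k) :=
  lines [set x | 0 < dot x u * dot x v].

Lemma cone_same_side u v : cone [set x | 0 < dot x u * dot x v].
Proof.
move=> c x c0 /= h; rewrite !dotZl mulrACA -expr2 mulr_gt0 //.
by rewrite exprn_even_gt0.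
Qed.

Lemma measurable_same_side u v : measurable (same_side u v).
Proof.
apply: measurable_lines.
apply: (@open_comp _ _ (fun x => dot x u * dot x v) [set r | 0 < r]).
  by move=> x _; exact: dot_prod_continuous.
exact: open_gt.
Qed.

Lemma positive_partE (v1 v2 : punctured R k.+1) :
  positive_part v1 v2 = same_side v1 v2.
Proof. by []. Qed.

Lemma negative_partE (v1 v2 : punctured R k.+1) :
  negative_part v1 v2 = same_side v1 (- (v2 : 'rV[R]_k.+1)).
Proof.
by rewrite /negative_part /same_side /lines; congr image;
   apply/seteqP; split=> x /=; rewrite dotNr mulrN oppr_gt0.
Qed.

Lemma same_side_eq u v u' v' :
  (forall x, dot x u * dot x v = dot x u' * dot x v') ->
  same_side u v = same_side u' v'.
Proof.
by move=> h; congr lines; apply/seteqP; split=> x /=; rewrite h.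
Qed.

Lemma same_sideZ (c d : R) u v : 0 < c -> 0 < d ->
  same_side (c *: u) (d *: v) = same_side u v.
Proof.
move=> c0 d0; congr lines; apply/seteqP.
by split=> x /=; rewrite !dotZr mulrACA (pmulr_rgt0 _ (mulr_gt0 c0 d0)).
Qed.

(** A closed neighbourhood of the two hyperplanes orthogonal to [u] and [v]: for
    [d = 0] it is their union. The factor [`|x| ^+ 2] makes the condition
    homogeneous. *)
Definition slab u v (d : R) : set (RP R k) :=
  lines [set x | `|dot x u * dot x v| <= d * `|x| ^+ 2].

Lemma cone_slab u v d : cone [set x | `|dot x u * dot x v| <= d * `|x| ^+ 2].
Proof.
move=> c x c0 /= h; rewrite !dotZl mulrACA -expr2 normrM normrX.
by rewrite (normrZ c x) exprMn mulrCA ler_wpM2l ?exprn_ge0.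
Qed.

Lemma measurable_slab u v d : measurable (slab u v d).
Proof.
apply: measurable_linesC; first exact: cone_slab.
have -> : [set x | `|dot x u * dot x v| <= d * `|x| ^+ 2] =
  (fun x => d * `|x| ^+ 2 - `|dot x u * dot x v|) @^-1` [set r | 0 <= r].
  by apply/seteqP; split=> x /=; rewrite subr_ge0.
apply: preimage_closed; last exact: closed_ge.
move=> x _; have nx := @norm_continuous _ 'rV[R]_k.+1 x.
exact: (cvgB (cvgM (cvg_cst d) (cvgM nx nx)) (cvg_norm (@dot_prod_continuous u v x))).
Qed.

Section Measure.
Variable mu : probability (RP R k) R.
Hypothesis mu_ac : absolutely_continuous mu.

Lemma hyperplane_measure0 u : u != 0 -> mu (lines [set x | dot x u = 0]) = 0%E.
Proof.
move=> u0; apply: mu_ac; last exact: RP_null_hyperplane.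
apply: measurable_linesC; first exact: cone_hyperplane.
apply: (@preimage_closed _ _ (fun x => dot x u) [set 0]).
  by move=> x _; exact: dot_continuous.
exact: closed_eq.
Qed.

Lemma slab0_measure0 u v : u != 0 -> v != 0 -> mu (slab u v 0) = 0%E.
Proof.
have mH w : measurable (lines [set x | dot x w = 0] : set (RP R k)).
  apply: measurable_linesC; first exact: cone_hyperplane.
  apply: (@preimage_closed _ _ (fun x => dot x w) [set 0]).
    by move=> x _; exact: dot_continuous.
  exact: closed_eq.
move=> u0 v0; apply: (@subset_measure0 _ _ _ mu _
    (lines [set x | dot x u = 0] `|` lines [set x | dot x v = 0])).
- exact: measurable_slab.
- exact: measurableU.
- move=> _ [x /= + <-]; rewrite mul0r normr_le0 mulf_eq0.
  by case/orP => /eqP h; [left|right]; exists x.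
- by apply: null_set_setU => //; exact: hyperplane_measure0.
Qed.

Lemma slab_measure_small u v (e : R) : u != 0 -> v != 0 -> 0 < e ->
  exists2 d : R, 0 < d & fine (mu (slab u v d)) < e.
Proof.
move=> u0 v0 e0; pose U n := slab u v n.+1%:R^-1.
have capU : \bigcap_n U n = slab u v 0.
  apply/seteqP; split=> p; have [x ->] := RP_class_surj p.
    move=> h; apply/lines_class; first exact: cone_slab.
    rewrite /= mul0r; apply/ler_addgt0Pl => r r0; rewrite addr0.
    have [M M0 hM] : exists2 M : R, 0 < M & `|punctured_val x| ^+ 2 <= M.
      by exists (`|punctured_val x| ^+ 2 + 1); [rewrite ltr_wpDl // exprn_ge0|lra].
    have := h (Num.truncn (M / r)) I.
    move=> /(lines_class _ (@cone_slab _ _ _)) /= /le_trans; apply.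
    rewrite mulrC ler_pdivrMr // mulrC.
    apply: (le_trans hM); rewrite -ler_pdivrMr //.
    by apply/ltW/truncnS_gt.
  move=> /(lines_class _ (@cone_slab _ _ _)) /= h n _.
  apply/lines_class; first exact: cone_slab.
  by apply: (le_trans h); rewrite mul0r mulr_ge0.
have : (mu \o U) n @[n --> \oo] --> mu (\bigcap_n U n).
  apply: nonincreasing_cvg_mu.
  - by rewrite (le_lt_trans (probability_le1 _ _)) ?ltry //; exact: measurable_slab.
  - by move=> n; exact: measurable_slab.
  - by rewrite capU; exact: measurable_slab.
  - move=> n p np; apply/subsetPset/lines_subset => x /= /le_trans; apply.
    by rewrite ler_wpM2r ?exprn_ge0 // lef_pV2 ?posrE ?ltr0n // ler_nat.
rewrite capU slab0_measure0 // => /fine_cvg /cvgr_lt /(_ e e0) [n _ /(_ n)].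
by move=> /(_ (leqnn n)) /= h; exists n.+1%:R^-1; rewrite ?invr_gt0.
Qed.

(** For vectors close to [u] and [v], the new set differs from [same_side u v]
    only inside a slab, and the slabs shrink to a null set. *)
Lemma same_side_measure_continuous u v : u != 0 -> v != 0 ->
  fine (mu (same_side p.1 p.2)) @[p --> (u, v)] --> fine (mu (same_side u v)).
Proof.
move=> u0 v0; apply/cvgrPdist_lt => e e0.
have [d d0 Ud] := slab_measure_small u0 v0 e0.
have mS u' v' : mu (same_side u' v') \is a fin_num.
  by apply: fin_num_measure; exact: measurable_same_side.
have mU : mu (slab u v d) \is a fin_num.
  by apply: fin_num_measure; exact: measurable_slab.
have key u1 v1 u2 v2 : same_side u1 v1 `<=` same_side u2 v2 `|` slab u v d ->
    fine (mu (same_side u1 v1)) <= fine (mu (same_side u2 v2)) + fine (mu (slab u v d)).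
  move=> h; rewrite -fineD // fine_le //; first by rewrite fin_numD mS mU.
  apply: (@le_trans _ _ (mu (same_side u2 v2 `|` slab u v d))).
    rewrite le_measure ?inE //; first exact: measurable_same_side.
    by apply: measurableU; [exact: measurable_same_side|exact: measurable_slab].
  by apply: measureU2; [exact: measurable_same_side|exact: measurable_slab].
(* By bilinearity, psi p * |x|^2 bounds the change of <x, u> <x, v>. *)
pose C : R := k.+1%:R ^+ 2.
pose psi (p : 'rV[R]_k.+1 * 'rV[R]_k.+1) :=
  C * (`|p.1| * `|p.2 - v| + `|p.1 - u| * `|v|).
have psi0 : psi p @[p --> (u, v)] --> (0 : R).
  have -> : 0 = C * (`|u| * `|v - v| + `|u - u| * `|v|) :> R.
    by rewrite !subrr normr0 mulr0 mul0r addr0 mulr0.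
  have c1 : p.1 @[p --> (u, v)] --> u by exact: cvg_fst.
  have c2 : p.2 @[p --> (u, v)] --> v by exact: cvg_snd.
  apply: cvgM; first exact: cvg_cst.
  apply: cvgD; apply: cvgM.
  - exact: cvg_norm.
  - by apply: cvg_norm; apply: cvgB => //; exact: cvg_cst.
  - by apply: cvg_norm; apply: cvgB => //; exact: cvg_cst.
  - exact: cvg_cst.
have near_psi : \forall p \near (u, v), psi p < d by exact: (cvgr_lt _ psi0).
apply: filterS near_psi => -[u' v'] /= psid.
have close (x : punctured R k.+1) :
    `|dot x u' * dot x v' - dot x u * dot x v| < d * `|punctured_val x| ^+ 2.
  apply: (@le_lt_trans _ _ (psi (u', v') * `|punctured_val x| ^+ 2)); last first.
    by rewrite ltr_pM2r // exprn_gt0 // normr_gt0 punctured_neq0.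
  have -> : dot x u' * dot x v' - dot x u * dot x v =
      dot x u' * dot x (v' - v) + dot x (u' - u) * dot x v.
    by rewrite !dotDr !dotNr; ring.
  apply: (le_trans (ler_normD _ _)); rewrite !normrM.
  apply: (@le_trans _ _
    ((k.+1%:R * `|punctured_val x| * `|u'|) * (k.+1%:R * `|punctured_val x| * `|v' - v|) +
     (k.+1%:R * `|punctured_val x| * `|u' - u|) * (k.+1%:R * `|punctured_val x| * `|v|))).
    by apply: lerD; apply: ler_pM => //; exact: ler_norm_dot.
  by rewrite /psi /C /=; lra.
have sub1 : same_side u v `<=` same_side u' v' `|` slab u v d.
  move=> _ [x /= xp <-].
  have [h|h] := leP `|dot x u * dot x v| (d * `|punctured_val x| ^+ 2).
    by right; exists x.
  left; exists x => //=; have := close x.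
  by rewrite (gtr0_norm xp) in h; rewrite ltr_norml => /andP[? ?]; lra.
have sub2 : same_side u' v' `<=` same_side u v `|` slab u v d.
  move=> _ [x /= xp <-].
  have [h|h] := leP `|dot x u * dot x v| (d * `|punctured_val x| ^+ 2).
    by right; exists x.
  left; exists x => //=; have := close x; rewrite ltr_norml => /andP[h1 h2].
  move: h; rewrite ltr_normr => /orP[]; last lra.
  by apply: le_lt_trans; rewrite mulr_ge0 ?exprn_ge0 // ltW.
have := key _ _ _ _ sub1; have := key _ _ _ _ sub2.
by rewrite ltr_norml => h1 h2; apply/andP; split; lra.
Qed.

(** The excess of the measure of the positive part over that of the negative
    part of the partition defined by [u] and [v]. *)
Definition imbalance u v : R :=
  fine (mu (same_side u v)) - fine (mu (same_side u (- v))).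

Lemma imbalance_continuous u v : u != 0 -> v != 0 ->
  imbalance p.1 p.2 @[p --> (u, v)] --> imbalance u v.
Proof.
move=> u0 v0; apply: cvgB; first exact: same_side_measure_continuous.
have c1 : p.1 @[p --> (u, v)] --> u by exact: cvg_fst.
have c2 : - p.2 @[p --> (u, v)] --> - v by apply: cvgN; exact: cvg_snd.
apply: (cvg_comp2 (h := fun a b => fine (mu (same_side a b))) c1 c2).
by apply: same_side_measure_continuous; rewrite ?oppr_eq0.
Qed.

Lemma imbalanceN u v : imbalance u (- v) = - imbalance u v.
Proof. by rewrite /imbalance opprK opprB. Qed.

Lemma imbalanceZ (c d : R) u v : 0 < c -> 0 < d ->
  imbalance (c *: u) (d *: v) = imbalance u v.
Proof. by move=> c0 d0; rewrite /imbalance -scalerN !same_sideZ. Qed.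

Lemma imbalance_eq u v u' v' :
  (forall x, dot x u * dot x v = dot x u' * dot x v') ->
  imbalance u v = imbalance u' v'.
Proof.
move=> h; rewrite /imbalance (same_side_eq h); congr (_ - fine (mu _)).
by apply: same_side_eq => x; rewrite !dotNr !mulrN h.
Qed.

Lemma imbalance_le u v u' v' :
  (forall x, dot x u * dot x v <= dot x u' * dot x v') ->
  imbalance u v <= imbalance u' v'.
Proof.
have key a b a' b' : (forall x, dot x a * dot x b <= dot x a' * dot x b') ->
    fine (mu (same_side a b)) <= fine (mu (same_side a' b')).
  move=> h; rewrite fine_le ?fin_num_measure //; try exact: measurable_same_side.
  rewrite le_measure ?inE //; try exact: measurable_same_side.
  by apply: lines_subset => x /= /lt_le_trans; apply.
move=> h; apply: lerB; apply: key => // x.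
by rewrite !dotNr !mulrN lerN2.
Qed.

Lemma same_side_measureD u v : u != 0 -> v != 0 ->
  fine (mu (same_side u v)) + fine (mu (same_side u (- v))) = 1.
Proof.
move=> u0 v0.
have mS w w' : measurable (same_side w w') by exact: measurable_same_side.
have disj : same_side u v `&` same_side u (- v) = set0.
  apply/seteqP; split=> // p; have [x ->] := RP_class_surj p.
  move=> [/lines_class -/(_ (@cone_same_side _ _)) /= h].
  move=> /lines_class -/(_ (@cone_same_side _ _)) /=.
  by rewrite dotNr mulrN; lra.
have muE : mu (same_side u v `|` same_side u (- v) `|` slab u v 0) =
    (mu (same_side u v) + mu (same_side u (- v)))%E.
  rewrite measureU0 //; first exact: measureU.
  - exact: measurableU.
  - exact: measurable_slab.
  - exact: slab0_measure0.
rewrite -fineD ?fin_num_measure // -muE.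
have -> : same_side u v `|` same_side u (- v) `|` slab u v 0 = setT.
  apply/seteqP; split=> // p _; have [x ->] := RP_class_surj p.
  have [h|h|h] := ltgtP (dot x u * dot x v) 0.
  - by left; right; exists x => //=; rewrite dotNr mulrN; lra.
  - by left; left; exists x.
  - by right; exists x => //=; rewrite h normr0 mul0r.
by rewrite probability_setT.
Qed.

Lemma imbalance_same u : u != 0 -> imbalance u u = 1.
Proof.
move=> u0; have := same_side_measureD u0 u0; rewrite /imbalance.
suff -> : same_side u (- u) = set0 by rewrite measure0 /= subr0 addr0.
apply/seteqP; split=> // p [x /= + _]; rewrite dotNr mulrN -expr2.
by rewrite oppr_gt0 ltNge sqr_ge0.
Qed.

Lemma bisects_imbalance (v1 v2 : punctured R k.+1) :
  imbalance v1 v2 = 0 -> bisects v1 v2 mu.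
Proof.
have := same_side_measureD (punctured_neq0 v1) (punctured_neq0 v2).
rewrite /imbalance /bisects positive_partE negative_partE => h1 h2.
have mS w w' : mu (same_side w w') \is a fin_num.
  by apply: fin_num_measure; exact: measurable_same_side.
by split; rewrite -(fineK (mS _ _)); congr EFin; lra.
Qed.

End Measure.

(** Equal hyperplanes have proportional normal vectors, which leave one of the
    two parts empty. *)
Lemma bisects_hyperplane_neq (mu : probability (RP R k) R) (v1 v2 : punctured R k.+1) :
  bisects v1 v2 mu -> hyperplane v1 <> hyperplane v2.
Proof.
move=> [bp bn] eH.
have v10 := dot_gt0 (punctured_neq0 v1).
pose c := dot v2 v1 / dot v1 v1.
pose w : 'rV[R]_k.+1 := (v2 : 'rV[R]_k.+1) - c *: (v1 : 'rV[R]_k.+1).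
have wv1 : dot w v1 = 0.
  by rewrite dotC dotDr dotNr dotZr /c divfK ?lt0r_neq0 // dotC subrr.
have v2E : (v2 : 'rV[R]_k.+1) = c *: (v1 : 'rV[R]_k.+1).
  apply/eqP; rewrite -subr_eq0 -/w; apply/negPn/negP => w0.
  have : hyperplane v1 (RP_class (mkpunct w0)).
    by exists (mkpunct w0) => //=; rewrite mkpunctE.
  rewrite eH => /(lines_class _ (@cone_hyperplane _ _ _)) /=; rewrite mkpunctE.
  have := dot_gt0 w0; rewrite {2}/w dotDr dotNr dotZr wv1 mulr0 subr0.
  by move=> /lt0r_neq0/eqP.
have half : (2^-1 : R)%:E <> 0%E by move=> [] /eqP; rewrite invr_eq0 pnatr_eq0.
have [c0|c0] := leP 0 c.
  apply: half; rewrite -bn (_ : negative_part v1 v2 = set0) ?measure0 //.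
  apply/seteqP; split=> // p [x /= + _]; rewrite v2E dotZr mulrCA -expr2 ltNge.
  by rewrite mulr_ge0 // sqr_ge0.
apply: half; rewrite -bp (_ : positive_part v1 v2 = set0) ?measure0 //.
apply/seteqP; split=> // p [x /= + _]; rewrite v2E dotZr mulrCA -expr2 ltNge.
by rewrite mulr_le0_ge0 ?sqr_ge0 // ltW.
Qed.

End Quadrants.

(** * Choice of the pair that balances the first measure *)

Section Independent.
Variables (R : realType) (k : nat).
Implicit Types (a b x : 'rV[R]_k.+1) (c d s t : R).

(** Linear independence of two vectors. *)
Definition independent a b :=
  forall c d, c *: a + d *: b = 0 -> c = 0 /\ d = 0.

Lemma independent_sym a b : independent a b -> independent b a.
Proof. by move=> ab c d; rewrite addrC => /ab []. Qed.

Lemma independentZ c d a b : c != 0 -> d != 0 ->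
  independent a b -> independent (c *: a) (d *: b).
Proof.
move=> c0 d0 ab c' d'; rewrite !scalerA => /ab [/eqP + /eqP].
by rewrite !mulf_eq0 (negbTE c0) (negbTE d0) !orbF => /eqP-> /eqP->.
Qed.

Lemma independent_neq0 a b : independent a b -> a != 0.
Proof.
move=> ab; apply/negP => /eqP a0.
have [/eqP] : (1 : R) = 0 /\ (0 : R) = 0 by apply: ab; rewrite a0 scaler0 scale0r addr0.
by rewrite oner_eq0.
Qed.

Lemma RP_class_independent (x y : punctured R k.+1) :
  RP_class x <> RP_class y -> independent x y.
Proof.
move=> xy c d; have [-> |c0] := eqVneq c 0.
  rewrite scale0r add0r => /eqP; rewrite scaler_eq0 (negbTE (punctured_neq0 y)) orbF.
  by move/eqP.
have [-> |d0 /eqP] := eqVneq d 0.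
  rewrite scale0r addr0 => /eqP; rewrite scaler_eq0 (negbTE (punctured_neq0 x)) orbF.
  by move/eqP.
rewrite addr_eq0 => /eqP e; exfalso; apply/xy/RP_classP; exists (- (c / d)).
  by rewrite oppr_eq0 mulf_neq0 // invr_eq0.
by rewrite scaleNr mulrC -scalerA e scalerN opprK scalerA mulVf // scale1r.
Qed.

(** The normal vectors of the pair of hyperplanes attached to [a], [b] and [s]. *)
Definition mix_add a b s := (1 - s) *: a + s *: b.
Definition mix_sub a b s := (1 - s) *: a - s *: b.

Lemma mix_neq0 a b s : independent a b -> mix_add a b s != 0 /\ mix_sub a b s != 0.
Proof.
move=> ab; split; apply/negP => /eqP; rewrite /mix_sub -?scaleNr => /ab [] h1 h2; lra.
Qed.

Lemma dot_mix x a b s : dot x (mix_add a b s) * dot x (mix_sub a b s) =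
  ((1 - s) * dot x a) ^+ 2 - (s * dot x b) ^+ 2.
Proof. by rewrite /mix_add /mix_sub !dotDr dotNr !dotZr; ring. Qed.

Lemma cvg_mix (T : Type) (F : set_system T) {FF : Filter F}
    (fa fb : T -> 'rV[R]_k.+1) (fs : T -> R) a b s :
  fa @ F --> a -> fb @ F --> b -> fs @ F --> s ->
  mix_add (fa t) (fb t) (fs t) @[t --> F] --> mix_add a b s /\
  mix_sub (fa t) (fb t) (fs t) @[t --> F] --> mix_sub a b s.
Proof.
move=> ha hb hs.
have h1 : (1 - fs t) @[t --> F] --> 1 - s by apply: cvgB => //; exact: cvg_cst.
by split; [apply: cvgD|apply: cvgB]; apply: cvgZ.
Qed.

Section Selection.
Variables (mu : probability (RP R k) R) (e : R).
Hypotheses (mu_ac : absolutely_continuous mu) (e0 : 0 < e).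

(** The imbalance of [nu] for that pair. *)
Definition mix_imbalance (nu : probability (RP R k) R) a b s :=
  imbalance nu (mix_add a b s) (mix_sub a b s).

Lemma cvg_mix_imbalance (nu : probability (RP R k) R) (T : Type)
    (F : set_system T) {FF : Filter F}
    (fa fb : T -> 'rV[R]_k.+1) (fs : T -> R) a b s :
  absolutely_continuous nu -> independent a b ->
  fa @ F --> a -> fb @ F --> b -> fs @ F --> s ->
  mix_imbalance nu (fa t) (fb t) (fs t) @[t --> F] --> mix_imbalance nu a b s.
Proof.
move=> nu_ac ab ha hb hs; have [h1 h2] := cvg_mix ha hb hs.
have [n1 n2] := mix_neq0 s ab.
exact: (cvg_comp2 (h := imbalance nu) h1 h2 (imbalance_continuous nu_ac n1 n2)).
Qed.

Lemma mix_imbalance_sign nu c d a b s : `|c| = 1 -> `|d| = 1 ->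
  mix_imbalance nu (c *: a) (d *: b) s = mix_imbalance nu a b s.
Proof.
move=> c1 d1; apply: imbalance_eq => x; rewrite !dot_mix !dotZr.
have c2 : c ^+ 2 = 1 by rewrite -real_normK ?num_real // c1 expr1n.
have d2 : d ^+ 2 = 1 by rewrite -real_normK ?num_real // d1 expr1n.
by rewrite !exprMn c2 d2 !mul1r.
Qed.

Lemma mix_imbalance_swap nu a b s :
  mix_imbalance nu b a (1 - s) = - mix_imbalance nu a b s.
Proof.
rewrite /mix_imbalance -imbalanceN.
have -> : mix_add b a (1 - s) = mix_add a b s.
  by rewrite /mix_add opprB addrC subrKC addrC.
congr imbalance; rewrite /mix_sub [RHS]opprB; congr (_ *: _ - _).
by rewrite opprB subrKC.
Qed.

Lemma mix_imbalance_le nu a b s t : 0 <= s -> s <= t -> t <= 1 ->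
  mix_imbalance nu a b t <= mix_imbalance nu a b s.
Proof.
move=> s0 st t1; apply: imbalance_le => x; rewrite !dot_mix !exprMn.
apply: lerB; rewrite ler_wpM2r ?sqr_ge0 // ler_pXn2r // ?nnegrE; lra.
Qed.

(** The tilt [e * (1 - 2 * s)] makes the imbalance strictly decreasing in [s], at
    the price of an error of at most [e], and is odd under [s |-> 1 - s]. *)
Definition tilted a b s := mix_imbalance mu a b s + e * (1 - 2 * s).

Lemma tilted_lt a b s t : 0 <= s -> s < t -> t <= 1 ->
  tilted a b t < tilted a b s.
Proof.
move=> s0 st t1; apply: ler_ltD; first by apply: mix_imbalance_le => //; exact: ltW.
by rewrite ltr_pM2l //; lra.
Qed.

Lemma tilted_swap a b s : tilted b a (1 - s) = - tilted a b s.
Proof. by rewrite /tilted mix_imbalance_swap; ring. Qed.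

Lemma tilted_sign c d a b : `|c| = 1 -> `|d| = 1 ->
  tilted (c *: a) (d *: b) = tilted a b.
Proof. by move=> c1 d1; apply/funext => s; rewrite /tilted mix_imbalance_sign. Qed.

Lemma tilted0 a b : a != 0 -> tilted a b 0 = 1 + e.
Proof.
move=> a0; rewrite /tilted /mix_imbalance /mix_add /mix_sub.
by rewrite !subr0 !scale1r scale0r subr0 addr0 imbalance_same // mulr0 subr0 mulr1.
Qed.

Lemma cvg_tilted (T : Type) (F : set_system T) {FF : Filter F}
    (fa fb : T -> 'rV[R]_k.+1) (fs : T -> R) a b s :
  independent a b -> fa @ F --> a -> fb @ F --> b -> fs @ F --> s ->
  tilted (fa t) (fb t) (fs t) @[t --> F] --> tilted a b s.
Proof.
move=> ab ha hb hs; apply: cvgD; first exact: cvg_mix_imbalance.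
apply: cvgM; first exact: cvg_cst.
apply: cvgB; first exact: cvg_cst.
by apply: cvgM => //; exact: cvg_cst.
Qed.

(** The parameter in [[0, 1]] at which the tilted imbalance changes sign. As a
    supremum it is defined for all [a] and [b], so that near an independent pair
    it can be estimated without knowing that the neighbouring pairs are
    independent. *)
Definition balance a b : R := sup [set s | 0 <= s <= 1 /\ 0 < tilted a b s].

Lemma balance_ge a b s : 0 <= s <= 1 -> 0 < tilted a b s -> s <= balance a b.
Proof.
by move=> s01 ps; apply: ub_le_sup; [exists 1 => t [/andP[]]|split].
Qed.

Lemma balance_le a b s s' : 0 <= s <= 1 -> 0 <= s' <= 1 ->
  0 < tilted a b s' -> tilted a b s <= 0 -> balance a b <= s.
Proof.
move=> /andP[s0 s1] s'01 ps' ns; apply: ge_sup; first by exists s'.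
move=> t [/andP[t0 t1] pt]; rewrite leNgt; apply/negP => st.
by have := tilted_lt a b s0 st t1; lra.
Qed.

Lemma balanceP a b : independent a b ->
  0 < balance a b < 1 /\ tilted a b (balance a b) = 0.
Proof.
move=> ab; have p0 := tilted0 b (independent_neq0 ab); have e0' := e0.
have p1 : tilted a b 1 = - (1 + e).
  have -> : tilted a b 1 = tilted a b (1 - 0) by rewrite subr0.
  by rewrite tilted_swap tilted0 //; exact: independent_neq0 (independent_sym ab).
have [s] : exists2 s, s \in `[0, 1] & tilted a b s = 0.
  apply: IVT => //.
    apply: continuous_in_subspaceT => s _.
    by apply: cvg_tilted => //; exact: cvg_cst.
  have e1 : 0 <= 1 + e by rewrite addr_ge0 // ltW.
  by rewrite p0 p1 ge_min le_max oppr_le0 e1 orbT.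
rewrite in_itv /= => /andP[s0 s1] ps.
have s0' : 0 < s by rewrite lt_neqAle s0 andbT; apply/negP => /eqP h; move: ps; rewrite -h p0; lra.
have s1' : s < 1 by rewrite lt_neqAle s1 andbT; apply/negP => /eqP h; move: ps; rewrite h p1; lra.
suff bs : balance a b = s; first by rewrite bs s0' s1'.
(* If the supremum were less than s, their midpoint would belong to the set. *)
apply/eqP; rewrite eq_le (@balance_le a b s 0) ?s0 ?lexx ?ler01 ?p0 ?ps //; last by lra.
rewrite leNgt; apply/negP => h.
have b0 : 0 <= balance a b by apply: balance_ge; rewrite ?lexx ?ler01 // p0; lra.
have : 0 < tilted a b ((balance a b + s) / 2) by rewrite -ps; apply: tilted_lt; lra.
by move=> /balance_ge -/(_ ltac:(apply/andP; split; lra)); lra.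
Qed.

Lemma balance_unique a b s : independent a b -> 0 <= s <= 1 ->
  tilted a b s = 0 -> balance a b = s.
Proof.
move=> ab /andP[s0 s1] ps; have [/andP[b0 b1] pb] := balanceP ab.
have [h|h|//] := ltgtP (balance a b) s.
  by have := tilted_lt a b (ltW b0) h s1; lra.
by have := tilted_lt a b s0 h (ltW b1); lra.
Qed.

Lemma balance_swap a b : independent a b -> balance b a = 1 - balance a b.
Proof.
move=> ab; have [/andP[b0 b1] pb] := balanceP ab.
apply: balance_unique; [exact: independent_sym|by apply/andP; split; lra|].
by rewrite tilted_swap pb oppr0.
Qed.

Lemma balance_sign c d a b : `|c| = 1 -> `|d| = 1 ->
  balance (c *: a) (d *: b) = balance a b.
Proof. by move=> c1 d1; rewrite /balance tilted_sign. Qed.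

Lemma balance_continuous a b : independent a b ->
  balance p.1 p.2 @[p --> (a, b)] --> balance a b.
Proof.
move=> ab; have [/andP[b0 b1] pb] := balanceP ab; set s := balance a b in b0 b1 pb *.
have near_tilted t : tilted p.1 p.2 t @[p --> (a, b)] --> tilted a b t.
  by apply: cvg_tilted => //; [exact: cvg_fst|exact: cvg_snd|exact: cvg_cst].
apply/cvgrPdist_lt => r r0.
(* h is at most r / 2 and keeps s - h and s + h in the unit interval. *)
pose h := Num.min (r / 2) (Num.min (s / 2) ((1 - s) / 2)).
have h0 : 0 < h by rewrite /h !lt_min; apply/and3P; split; lra.
have [hr hs h1] : [/\ h <= r / 2, h <= s / 2 & h <= (1 - s) / 2].
  by split; rewrite /h !ge_min lexx ?orbT.
have pos : 0 < tilted a b (s - h) by rewrite -pb; apply: tilted_lt; lra.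
have neg : tilted a b (s + h) < 0 by rewrite -pb; apply: tilted_lt; lra.
near=> p.
have pp : 0 < tilted p.1 p.2 (s - h).
  by near: p; exact: (cvgr_gt _ (near_tilted (s - h))).
have pn : tilted p.1 p.2 (s + h) < 0.
  by near: p; exact: (cvgr_lt _ (near_tilted (s + h))).
have i1 : 0 <= s - h <= 1 by apply/andP; split; lra.
have i2 : 0 <= s + h <= 1 by apply/andP; split; lra.
have l1 := balance_ge i1 pp.
have l2 := balance_le i2 i1 pp (ltW pn).
by rewrite ltr_norml; apply/andP; split; lra.
Unshelve. all: by end_near. Qed.

End Selection.
End Independent.

(** * The equivariant map *)

Lemma cvg_row (R : realType) (m : nat) (T : Type) (F : set_system T)
    {FF : Filter F} (f : 'I_m -> T -> R) (l : 'I_m -> R) :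
  (forall i, f i t @[t --> F] --> l i) ->
  (\row_i f i t : 'rV[R]_m) @[t --> F] --> (\row_i l i : 'rV[R]_m).
Proof.
move=> fl; rewrite (row_sum_delta (\row_i l i)).
rewrite (_ : (fun t => _) = (fun t => \sum_i f i t *: 'e_i)); last first.
  apply/funext => t; rewrite [LHS]row_sum_delta.
  by apply: eq_bigr => i _; rewrite mxE.
apply: cvg_big => [|i _]; first exact: add_continuous.
by rewrite mxE; apply: cvgZr_tmp.
Qed.

Section EuclideanNormalization.
Variables (R : realType) (m : nat).
Implicit Types w : 'rV[R]_m.

(** The projection to the Euclidean sphere. *)
Definition normalize w : 'rV[R]_m := (Num.sqrt (dot w w))^-1 *: w.

Lemma normalize_sphere w : w != 0 -> sphere (normalize w).
Proof.
move=> /dot_gt0 w0; rewrite /sphere /normalize /= dotZl dotZr mulrA -invfM.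
by rewrite -expr2 sqr_sqrtr ?ltW // mulVf // lt0r_neq0.
Qed.

Lemma normalizeN w : normalize (- w) = - normalize w.
Proof. by rewrite /normalize dotNr dotC dotNr opprK scalerN. Qed.

Lemma cvg_normalize (T : Type) (F : set_system T) {FF : Filter F} (f : T -> 'rV[R]_m) w :
  w != 0 -> f @ F --> w -> normalize (f t) @[t --> F] --> normalize w.
Proof.
move=> w0 fw; apply: cvgZ => //; apply: cvgV.
  by rewrite lt0r_neq0 // sqrtr_gt0 dot_gt0.
have h : dot (f t) (f t) @[t --> F] --> dot w w by exact: cvg_dot.
by apply: (cvg_comp (fun t => dot (f t) (f t)) Num.sqrt h); exact: sqrt_continuous.
Qed.

End EuclideanNormalization.

Section UnitVectors.
Variables (R : realType) (k : nat).
Implicit Types a : 'rV[R]_k.+1.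

(** The rescaling to norm 1, for the maximum norm. *)
Definition unitize a : 'rV[R]_k.+1 := `|a|^-1 *: a.

Lemma norm_unitize a : a != 0 -> `|unitize a| = 1.
Proof.
move=> a0; rewrite /unitize normrZ ger0_norm ?invr_ge0 //.
by rewrite mulVf // normr_eq0.
Qed.

Lemma unitizeZ (c : R) a : c != 0 -> unitize (c *: a) = (c / `|c|) *: unitize a.
Proof.
by move=> c0; rewrite /unitize normrZ !scalerA; congr (_ *: _); rewrite invfM; ring.
Qed.

Lemma norm_sign (c : R) : c != 0 -> `|c / `|c| | = 1.
Proof. by move=> c0; rewrite normrM normfV normr_id divff // normr_eq0. Qed.

Lemma cvg_unitize a : a != 0 -> unitize x @[x --> a] --> unitize a.
Proof.
move=> a0; have na0 : `|a| != 0 by rewrite normr_eq0.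
exact: (cvgZ (cvgV na0 (@norm_continuous _ 'rV[R]_k.+1 a)) cvg_id).
Qed.

Lemma compact_unit_vectors : compact [set a : 'rV[R]_k.+1 | `|a| = 1].
Proof.
apply: bounded_closed_compact.
  by exists 1; split => // M M1 x /= ->; exact: ltW.
apply: (@preimage_closed _ _ (fun a : 'rV[R]_k.+1 => `|a|) [set 1]).
  by move=> x _; exact: norm_continuous.
exact: closed_eq.
Qed.

(** A function on [RP * RP] induced from vectors is continuous where the
    function of vectors is, the projection being open. *)
Lemma continuous_RP_prod (T : topologicalType) (f : RP R k * RP R k -> T)
    (g : 'rV[R]_k.+1 -> 'rV[R]_k.+1 -> T) (x y : punctured R k.+1) :
  (forall x y : punctured R k.+1, f (RP_class x, RP_class y) = g x y) ->
  g p.1 p.2 @[p --> (x : 'rV[R]_k.+1, y : 'rV[R]_k.+1)] --> g x y ->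
  {for (RP_class x, RP_class y), continuous f}.
Proof.
move=> fg gc W; rewrite /= fg => /gc [[A B] /= [xA yB] AB].
exists (lines A, lines B) => /=; first by split; exact: nbhs_lines.
move=> [p q] [/= [a Aa <-] [b Bb <-]]; rewrite /= fg.
exact: (AB (punctured_val a, punctured_val b)).
Qed.

End UnitVectors.

(** The imbalances depend only on the directions of [u] and [v], so compactness of
    the set of unit vectors applies. *)
Lemma imbalance_bounded_below (R : realType) (k m : nat)
    (mu : 'I_m -> probability (RP R k) R) :
  (forall i, absolutely_continuous (mu i)) ->
  (forall u v, u != 0 -> v != 0 -> exists i, imbalance (mu i) u v != 0) ->
  exists2 d : R, 0 < d & forall u v, u != 0 -> v != 0 ->
    d <= \sum_i `|imbalance (mu i) u v|.
Proof.
move=> mu_ac nobis.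
pose S : set 'rV[R]_k.+1 := [set a | `|a| = 1].
have S0 a : S a -> a != 0 by rewrite -normr_eq0 => ->; rewrite oner_eq0.
pose g (p : 'rV[R]_k.+1 * 'rV[R]_k.+1) := \sum_i `|imbalance (mu i) p.1 p.2|.
have [] := @compact_EVT_min _ R g (S `*` S).
- pose a : 'rV[R]_k.+1 := unitize (const_mx 1).
  have a1 : `|a| = 1.
    apply: norm_unitize; apply/negP => /eqP/rowP/(_ 0).
    by rewrite !mxE => /eqP; rewrite oner_eq0.
  by exists (a, a).
- by apply: compact_setX; exact: compact_unit_vectors.
- apply: continuous_in_subspaceT => -[u v]; rewrite inE => -[/= /S0 u0 /S0 v0].
  apply: cvg_big => [|i _]; first exact: add_continuous.
  by apply: cvg_norm; exact: imbalance_continuous.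
move=> [u v]; rewrite inE => -[/= /S0 u0 /S0 v0] gmin.
exists (g (u, v)).
  have [i hi] := nobis u v u0 v0.
  rewrite /g (bigD1 i) //= ltr_pwDl ?normr_gt0 //.
  by apply: sumr_ge0.
move=> u' v' u'0 v'0.
have := gmin (unitize u', unitize v').
rewrite inE => /(_ (conj (norm_unitize u'0) (norm_unitize v'0))).
move=> /le_trans; apply; rewrite le_eqVlt; apply/orP; left; apply/eqP.
by apply: eq_bigr => i _; rewrite /= imbalanceZ // invr_gt0 normr_gt0.
Qed.

Section EquivariantMap.
Variables (R : realType) (k m : nat) (mu : 'I_m.+1 -> probability (RP R k) R).
Hypothesis mu_ac : forall i, absolutely_continuous (mu i).
Variable e : R.
Hypothesis e0 : 0 < e.
Implicit Types a b : 'rV[R]_k.+1.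

(** The imbalances of the measures other than the first, for the pair that
    balances the tilted first measure. *)
Definition other_imbalances a b : 'rV[R]_m :=
  \row_i mix_imbalance (mu (lift ord0 i)) a b (balance (mu ord0) e a b).

Lemma other_imbalances_swap a b : independent a b ->
  other_imbalances b a = - other_imbalances a b.
Proof.
move=> ab; apply/rowP => i; rewrite [LHS]mxE [RHS]mxE [in RHS]mxE.
rewrite (balance_swap (mu_ac ord0) e0 ab).
exact: mix_imbalance_swap.
Qed.

Lemma other_imbalances_sign (c d : R) a b : `|c| = 1 -> `|d| = 1 ->
  other_imbalances (c *: a) (d *: b) = other_imbalances a b.
Proof.
move=> c1 d1; apply/rowP => i; rewrite [LHS]mxE [RHS]mxE.
by rewrite (balance_sign (mu ord0) e a b c1 d1); exact: mix_imbalance_sign.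
Qed.

Lemma other_imbalances_continuous a b : independent a b ->
  other_imbalances p.1 p.2 @[p --> (a, b)] --> other_imbalances a b.
Proof.
move=> ab; apply: cvg_row => i; apply: cvg_mix_imbalance => //.
- exact: cvg_fst.
- exact: cvg_snd.
- exact: (balance_continuous (mu_ac ord0) e0).
Qed.

(** At the balancing parameter the imbalance of the first measure is at most [e],
    so those of the other measures cannot all vanish. *)
Lemma other_imbalances_neq0 a b :
  (forall u v, u != 0 -> v != 0 -> e < \sum_i `|imbalance (mu i) u v|) ->
  independent a b -> other_imbalances a b != 0.
Proof.
move=> far ab; apply/negP => /eqP/rowP w0.
have [/andP[s0 s1]] := balanceP (mu_ac ord0) e0 ab.
move: w0; rewrite /other_imbalances.
set s := balance (mu ord0) e a b in s0 s1 *; rewrite /tilted => w0 tE.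
have [u0 v0] := mix_neq0 s ab.
have := far _ _ u0 v0; rewrite big_ord_recl big1 ?addr0; last first.
  by move=> i _; have := w0 i; rewrite !mxE /mix_imbalance => ->; rewrite normr0.
apply/negP; rewrite -leNgt -/(mix_imbalance (mu ord0) a b s).
have -> : mix_imbalance (mu ord0) a b s = - (e * (1 - 2 * s)) by lra.
rewrite normrN normrM (gtr0_norm e0) ger_pMr //.
by rewrite ler_norml; apply/andP; split; lra.
Qed.

(** The point of the sphere attached to the lines of [a] and [b]. Unit vectors are
    used because the balancing parameter depends on the norms. *)
Definition vector_map a b : 'rV[R]_m :=
  normalize (other_imbalances (unitize a) (unitize b)).

Lemma vector_mapZ (c d : R) a b : c != 0 -> d != 0 ->
  vector_map (c *: a) (d *: b) = vector_map a b.
Proof.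
move=> c0 d0; rewrite /vector_map (unitizeZ a c0) (unitizeZ b d0).
by rewrite (other_imbalances_sign _ _ (norm_sign c0) (norm_sign d0)).
Qed.

Lemma independent_unitize a b :
  independent a b -> independent (unitize a) (unitize b).
Proof.
move=> ab; apply: independentZ => //; rewrite invr_eq0 normr_eq0.
  exact: independent_neq0 ab.
exact: independent_neq0 (independent_sym ab).
Qed.

Lemma vector_map_continuous a b : independent a b ->
  other_imbalances (unitize a) (unitize b) != 0 ->
  vector_map p.1 p.2 @[p --> (a, b)] --> vector_map a b.
Proof.
move=> ab w0; have ab' := independent_unitize ab.
have a0 := independent_neq0 ab; have b0 := independent_neq0 (independent_sym ab).
have ca : unitize p.1 @[p --> (a, b)] --> unitize a.
  by apply: (cvg_comp fst (@unitize R k) cvg_fst); exact: cvg_unitize.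
have cb : unitize p.2 @[p --> (a, b)] --> unitize b.
  by apply: (cvg_comp snd (@unitize R k) cvg_snd); exact: cvg_unitize.
apply: (cvg_comp2 (h := fun a b => normalize (other_imbalances a b)) ca cb).
exact: (cvg_normalize w0 (other_imbalances_continuous ab')).
Qed.

(** The map induced on pairs of lines; the choice of the representatives does not
    matter by [line_mapE]. *)
Definition line_map (p : RP R k * RP R k) : 'rV[R]_m :=
  vector_map (punctured_val (repr p.1)) (punctured_val (repr p.2)).

Lemma line_mapE (x y : punctured R k.+1) :
  line_map (RP_class x, RP_class y) = vector_map x y.
Proof.
have reprE (z : punctured R k.+1) : exists2 c : R, c != 0 &
    punctured_val (repr (RP_class z)) = c *: punctured_val z.
  by apply/RP_classP; rewrite /RP_class reprK.
rewrite /line_map; have [c c0 /= ->] := reprE x; have [d d0 /= ->] := reprE y.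
exact: vector_mapZ.
Qed.

Lemma line_map_equivariant :
  (forall u v, u != 0 -> v != 0 -> e < \sum_i `|imbalance (mu i) u v|) ->
  equivariant_to_sphere line_map.
Proof.
move=> far; split.
- apply: continuous_in_subspaceT => -[p q].
  have [x ->] := RP_class_surj p; have [y ->] := RP_class_surj q.
  rewrite inE => /RP_class_independent xy; apply: (continuous_RP_prod line_mapE).
  apply: vector_map_continuous => //; apply: other_imbalances_neq0 => //.
  exact: independent_unitize.
- move=> [p q]; have [x ->] := RP_class_surj p; have [y ->] := RP_class_surj q.
  move=> /RP_class_independent xy; rewrite line_mapE.
  apply: normalize_sphere; apply: other_imbalances_neq0 => //.
  exact: independent_unitize.
- move=> p q; have [x ->] := RP_class_surj p; have [y ->] := RP_class_surj q.
  move=> /RP_class_independent xy; rewrite !line_mapE /vector_map.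
  by rewrite (other_imbalances_swap (independent_unitize xy)) normalizeN.
Qed.

End EquivariantMap.

Theorem theorem10 (R : realType) (n m : nat) (n_gt0 : (0 < n)%N) (m_gt0 : (0 < m)%N)
  (obstruction : ~ exists f : RP R n.-1 * RP R n.-1 -> 'rV[R]_m,
    equivariant_to_sphere f)
  (mu : 'I_m.+1 -> probability (RP R n.-1) R)
  (mu_ac : forall i, absolutely_continuous (mu i)) :
  exists v1 v2 : punctured R n.-1.+1,
    hyperplane v1 <> hyperplane v2 /\ forall i, bisects v1 v2 (mu i).
Proof.
apply: contrapT => nobis; apply: obstruction.
have unbalanced u v : u != 0 -> v != 0 -> exists i, imbalance (mu i) u v != 0.
  move=> u0 v0; apply: contrapT => balanced; apply: nobis.
  exists (mkpunct u0), (mkpunct v0).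
  have bis i : bisects (mkpunct u0) (mkpunct v0) (mu i).
    apply: bisects_imbalance => //; rewrite !mkpunctE.
    by apply: contrapT => /eqP h; apply: balanced; exists i.
  by split => //; exact: bisects_hyperplane_neq (bis ord0).
have [d d0 dmin] := imbalance_bounded_below mu_ac unbalanced.
have e0 : 0 < d / 2 by rewrite divr_gt0.
exists (line_map mu (d / 2)).
apply: line_map_equivariant => // u v u0 v0.
by apply: (lt_le_trans _ (dmin u v u0 v0)); lra.
Qed.
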